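(* Let $I$, $J$, $(\nu_{n,k})$, $(K_{n,k})$ and the operators $S_n$ be as in the context, let $d>1$ be an integer, and let $\gamma:I\to\mathbb{R}^d$ be a bounded function. Then the following statements hold. (i) For every $n\in\mathbb{N}^+$, $S_n\gamma$ is a bounded and continuous function from $I$ to $\mathbb{R}^d$. (ii) $\lim_{n\to+\infty}(S_n\gamma)(t)=\gamma(t)$ for every point $t\in I$ of continuity of $\gamma$. (iii) If $\gamma$ is also uniformly continuous on $I$ and condition (4) of the context is satisfied uniformly with respect to $t\in I$ (that is, for every $\delta>0$, $\lim_{n\to+\infty}\sup_{t\in I}\sum_{k\in J,\,|\nu_{n,k}-t|\ge\delta}|K_{n,k}(t)|=0$), then $\lim_{n\to+\infty}\|S_n\gamma-\gamma\|_\infty=0$.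
   Context: Let $I\subset\mathbb{R}$ be an interval (bounded or not). For each $n\in\mathbb{N}^+=\{1,2,3,\dots\}$ let $J\subset\mathbb{Z}$ be an at most countable index set ($J$ is allowed to depend on $n$) and let $(\nu_{n,k})_{k\in J}\subset I$ be a sequence of points such that $\lambda_n<\nu_{n,k+1}-\nu_{n,k}\le\Lambda_n$ for every $k\in J$ (with $k+1\in J$), where $\lambda_n,\Lambda_n>0$ and $\lim_{n\to+\infty}\lambda_n=\lim_{n\to+\infty}\Lambda_n=0$. Let $K_{n,k}:I\to\mathbb{R}$ ($n\in\mathbb{N}^+$, $k\in J$) be continuous functions such that: (1) $\sum_{k\in J}K_{n,k}(t)=1$ for every $n\in\mathbb{N}^+$ and $t\in I$; (2) for every $n\in\mathbb{N}^+$, the series $\sum_{k\in J}|K_{n,k}(t)|$ converges uniformly on compact subsets of $I$; (3) there exists $M_0$ such that $m_0(n):=\sup_{t\in I}\sum_{k\in J}|K_{n,k}(t)|<M_0$ for every $n\in\mathbb{N}^+$; (4) $\lim_{n\to+\infty}\sum_{k\in J,\,|\nu_{n,k}-t|\ge\delta}|K_{n,k}(t)|=0$ for every $\delta>0$ and $t\in I$. For a bounded function $f:I\to\mathbb{R}$ and $n\in\mathbb{N}^+$, define $(S_nf)(t)=\sum_{k\in J}f(\nu_{n,k})K_{n,k}(t)$ for $t\in I$. For a bounded function $\gamma:I\to\mathbb{R}^d$ with components $\gamma(t)=(x_1(t),\dots,x_d(t))$, define $S_n\gamma:I\to\mathbb{R}^d$ by $(S_n\gamma)(t):=((S_nx_1)(t),\dots,(S_nx_d)(t))$,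 equivalently $(S_n\gamma)(t)=\sum_{k\in J}\gamma(\nu_{n,k})K_{n,k}(t)$. Norms: for a bounded $g:I\to\mathbb{R}$, $\|g\|_\infty:=\sup_{t\in I}|g(t)|$; for a bounded $\gamma:I\to\mathbb{R}^d$ with components $x_1,\dots,x_d$, $\|\gamma\|_\infty:=\max_{i=1,\dots,d}\|x_i\|_\infty$. *)

(* Defs.v *)
From mathcomp Require Import all_boot all_order all_algebra.
From mathcomp Require Import finmap.
From mathcomp Require Import all_classical all_reals all_analysis.
From mathcomp Require summability.

Set Implicit Arguments.
Unset Strict Implicit.
Unset Printing Implicit Defensive.

Import Order.TTheory GRing.Theory Num.Theory.
Import numFieldNormedType.Exports.

Local Open Scope classical_set_scope.
Local Open Scope ring_scope.

(* The sum over [J] is the unordered sum: the limit of the finite partial sums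
   along the inclusion filter [totally]. It is used only for absolutely
   convergent families, for which the limit exists and agrees with every
   ordered summation. *)
Definition sampling_op (R : realType) (J : set int) (nu : int -> R)
    (K : int -> R -> R) (f : R -> R) (t : R) : R :=
  summability.sum (fun k : J => f (nu (val k)) * K (val k) t).

Definition sampling_op_vec (R : realType) (d : nat) (J : set int)
    (nu : int -> R) (K : int -> R -> R) (gamma : R -> 'rV[R]_d) (t : R) :
    'rV[R]_d :=
  \row_(i < d) sampling_op J nu K (fun s => gamma s ord0 i) t.

Definition abs_partial_sum (R : realType) (J : set int) (K : int -> R -> R)
    (A : {fset J}) (t : R) : R :=
  summability.partial_sum (fun k : J => `|K (val k) t|) A.

(* Valued in [\bar R], so that an unbounded function gets norm [+oo] instead of
   the default value of the real [sup].  The [0] in the maximum below is neutral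
   because the norm of a function on a nonempty set is nonnegative. *)
Definition sup_norm (R : realType) (I : set R) (g : R -> R) : \bar R :=
  ereal_sup [set `|g t|%:E | t in I].

Definition sup_norm_vec (R : realType) (d : nat) (I : set R)
    (g : R -> 'rV[R]_d) : \bar R :=
  \big[maxe/0%E]_(i < d) sup_norm I (fun t => g t ord0 i).

(* Main.v *)
(** Since [sum_k K_k(t) = 1], the error [S_n f t - f t] is
    [sum_k (f nu_k - f t) K_k(t)]. The indices with [|nu_k - t| < delta]
    contribute at most the oscillation of [f] near [t] times the uniform bound
    on [sum_k |K_k|]; the others contribute at most [2 sup|f|] times the tail
    that condition (4) sends to [0]. Continuity of [S_n f] holds because its
    series is dominated by the uniformly convergent series of the [|K_k|] on a
    segment of [I] that is a neighborhood in [I] of the given point. *)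
Require Import Defs.
From mathcomp Require Import all_boot all_order all_algebra.
From mathcomp Require Import finmap lra.
From mathcomp Require Import all_classical all_reals all_analysis.
From mathcomp Require summability.
Set Implicit Arguments.
Unset Strict Implicit.
Unset Printing Implicit Defensive.
Import Order.TTheory GRing.Theory Num.Theory.
Import numFieldNormedType.Exports.
Local Open Scope classical_set_scope.
Local Open Scope ring_scope.

#[local] Existing Instance summability.totally_filter.

(** * Partial sums and unordered sums of real families *)

Lemma partial_sumE (R : zmodType) (T : choiceType) (x : T -> R) (A : {fset T}) :
  summability.partial_sum x A = \sum_(i <- A) x i.
Proof. by rewrite [RHS]big_seq_fsetE. Qed.

Lemma partial_sumD (R : zmodType) (T : choiceType) (x y : T -> R) :
  summability.partial_sum (x \+ y) =
    summability.partial_sum x \+ summability.partial_sum y.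
Proof. by apply/funext => A; rewrite /= !partial_sumE big_split. Qed.

Lemma partial_sumB (R : zmodType) (T : choiceType) (x y : T -> R) :
  summability.partial_sum (x \- y) =
    summability.partial_sum x \- summability.partial_sum y.
Proof. by apply/funext => A; rewrite /= !partial_sumE sumrB. Qed.

Lemma partial_sumZ (R : pzRingType) (T : choiceType) (c : R) (x : T -> R) :
  summability.partial_sum (fun i => c * x i) =
    (fun A => c * summability.partial_sum x A).
Proof. by apply/funext => A; rewrite !partial_sumE mulr_sumr. Qed.

Section unordered_sums.
Context {R : realType} {T : choiceType}.
Implicit Types (x y : T -> R) (A : {fset T}).

Local Notation psum := summability.partial_sum.
Local Notation usum := summability.sum.
Local Notation totally := (@summability.totally T).

Lemma le_partial_sum x y A :
  (forall i, x i <= y i) -> psum x A <= psum y A.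
Proof. by move=> xy; rewrite !partial_sumE ler_sum. Qed.

Lemma partial_sum_subset x A B : (forall i, 0 <= x i) ->
  (A `<=` B)%fset -> psum x A <= psum x B.
Proof.
move=> x0 AB; rewrite !partial_sumE.
(* The sum over [B] splits along membership in [A]: the part inside [A] is the sum over [A], and the
   rest is nonnegative. *)
rewrite [leRHS](big_fsetID _ (mem A))/= [X in X + _](_ : _ = \sum_(i <- A) x i).
  by rewrite lerDl sumr_ge0.
congr (\sum_(i <- _) _); congr enum_fset; apply/fsetP => i.
by rewrite !inE/= andbC; case: (boolP (i \in A)) => //= /(fsubsetP AB) ->.
Qed.

(** The limit is the supremum of the partial sums: one of them within [e] of it stays so as the
    finite set grows. *)
Lemma nonneg_partial_sum_cvg x B : (forall i, 0 <= x i) ->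
  (forall A, psum x A <= B) -> cvg (psum x @ totally).
Proof.
move=> x0 xB; set S := range (psum x).
have hS : has_sup S.
  by split; [exists (psum x fset0), fset0|exists B => _ [A _ <-]].
apply/cvg_ex; exists (sup S); apply/cvgrPdist_le => e e0.
have [_ [A _ <-] SA] := sup_adherent e0 hS.
exists A => //= C AC.
have AleC := partial_sum_subset x0 AC.
have CS : psum x C <= sup S by apply: ub_le_sup; [exact: hS.2|exists C].
by rewrite ger0_norm; lra.
Qed.

Lemma nonneg_partial_sum_le x A : (forall i, 0 <= x i) ->
  cvg (psum x @ totally) -> psum x A <= usum x.
Proof.
move=> x0 cx; apply: limr_ge => //; exists A => //= B AB.
exact: partial_sum_subset.
Qed.

Lemma usumB x y : cvg (psum x @ totally) -> cvg (psum y @ totally) ->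
  usum (x \- y) = usum x - usum y.
Proof. by move=> cx cy; rewrite /usum partial_sumB; apply: limB. Qed.

Lemma usumZ c x : cvg (psum x @ totally) ->
  usum (fun i => c * x i) = c * usum x.
Proof.
move=> cx; rewrite /usum partial_sumZ.
by apply: cvg_lim => //; apply: cvgM cx; exact: cvg_cst.
Qed.

(** Both [y] and [y - x] are nonnegative with bounded partial sums, as [y - x <= y + y]; hence
    [x = y - (y - x)] is a difference of convergent families. *)
Lemma dominated_partial_sum_cvg x y B : (forall i, `|x i| <= y i) ->
  (forall A, psum y A <= B) -> cvg (psum x @ totally).
Proof.
move=> xy yB.
have y0 i : 0 <= y i by apply: le_trans (xy i).
have cy := nonneg_partial_sum_cvg y0 yB.
have xy0 i : 0 <= (y \- x) i by rewrite subr_ge0 (le_trans (ler_norm _)).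
have cyx : cvg (psum (y \- x) @ totally).
  apply: (@nonneg_partial_sum_cvg _ (B + B)) => // A.
  rewrite (@le_trans _ _ (psum (y \+ y) A))//.
    apply: le_partial_sum => i /=; rewrite lerD2l.
    by have := xy i; rewrite ler_norml => /andP[]; lra.
  by rewrite partial_sumD lerD.
rewrite (_ : x = y \- (y \- x)); last by apply/funext => i /=; lra.
by rewrite partial_sumB; exact: is_cvgB.
Qed.

(* Apply monotonicity of partial sums to the nonnegative families [y - x] and
   [y + x]. *)
Lemma dominated_tail_le x y B A : (forall i, `|x i| <= y i) ->
  (forall A, psum y A <= B) -> `|usum x - psum x A| <= usum y - psum y A.
Proof.
have aux (z : T -> R) : (forall i, `|z i| <= y i) -> (forall A, psum y A <= B) ->
    usum z - psum z A <= usum y - psum y A.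
  move=> zy yB.
  have cz := dominated_partial_sum_cvg zy yB.
  have y0 i : 0 <= y i by apply: le_trans (zy i).
  have cy := nonneg_partial_sum_cvg y0 yB.
  have /(_ A) : forall A, psum (y \- z) A <= usum (y \- z).
    move=> C; apply: nonneg_partial_sum_le.
      by move=> i; rewrite subr_ge0 (le_trans (ler_norm _)).
    by rewrite partial_sumB; exact: is_cvgB.
  by rewrite usumB// partial_sumB/=; lra.
move=> xy yB; rewrite ler_norml (aux x)// andbT lerNl.
have cx := dominated_partial_sum_cvg xy yB.
have := aux (fun i => -1 * x i); rewrite usumZ// partial_sumZ => h.
by rewrite (le_trans _ (h _ _))//; [lra|move=> i; rewrite mulN1r normrN].
Qed.

Lemma usum_le x B : (forall A, psum x A <= B) -> cvg (psum x @ totally) ->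
  usum x <= B.
Proof. by move=> xB cx; apply: limr_le => //; exists fset0 => //= A _. Qed.

(** This is the tail estimate at the empty set, where both partial sums vanish. *)
Lemma dominated_usum_le x y B : (forall i, `|x i| <= y i) ->
  (forall A, psum y A <= B) -> `|usum x| <= B.
Proof.
move=> xy yB; have := dominated_tail_le fset0 xy yB.
rewrite !partial_sumE !big_seq_fset0 !subr0 => /le_trans; apply.
apply: usum_le => //; apply: nonneg_partial_sum_cvg yB => i.
exact: le_trans (xy i).
Qed.

End unordered_sums.

(** Links sums over the type [J] to the [\esum] of the hypotheses: the image of [A] under the
    injection [val] is one of the finite subsets of [J] over which the supremum is taken. *)
Lemma partial_sum_le_esum {R : realType} {T : choiceType} (J : set T)
    (x : T -> R) (A : {fset J}) :
  ((summability.partial_sum (fun k : J => x (val k)) A)%:E <=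
   \esum_(k in J) (x k)%:E)%E.
Proof.
rewrite partial_sumE; apply: esum_ge; exists (val @` [set` A]).
  split; first exact/finite_image/finite_fset.
  by move=> _ [k _ <-]; exact: set_valP.
rewrite fsbig_image; last by move=> i j _ _; exact: val_inj.
by rewrite -sumEFin fsbig_finite//= set_fsetK.
Qed.

(** Take for [a] a point of [I] to the left of [t] if there is one; otherwise [t] is the least point
    of [I] and [a = t] works. The choice of [b] is symmetric. *)
Lemma interval_within_nbhs_segment {R : realType} (I : set R) (t : R) :
  is_interval I -> I t ->
  exists a b : R, `[a, b]%classic `<=` I /\ within I (nbhs t) `[a, b]%classic.
Proof.
move=> itvI It.
have [a [Ia a_le ta]] : exists a : R, [/\ I a, a <= t &
    \forall s \near t, I s -> a <= s].
  have [[a [Ia ta]]|nIa] := pselect (exists a, I a /\ a < t).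
    exists a; split=> //; first exact: ltW.
    by near=> s => _; apply: ltW; near: s; exact: lt_nbhsr.
  exists t; split=> //; near=> s => Is.
  by rewrite leNgt; apply/negP => st; apply: nIa; exists s.
have [b [Ib b_ge tb]] : exists b : R, [/\ I b, t <= b &
    \forall s \near t, I s -> s <= b].
  have [[b [Ib tb]]|nIb] := pselect (exists b, I b /\ t < b).
    exists b; split=> //; first exact: ltW.
    by near=> s => _; apply: ltW; near: s; exact: lt_nbhsl.
  exists t; split=> //; near=> s => Is.
  by rewrite leNgt; apply/negP => st; apply: nIb; exists s.
exists a, b; split=> [s /=|].
  by rewrite in_itv/=; exact: itvI.
apply: filterS2 ta tb => s sa sb Is /=.
by rewrite in_itv/= sa// sb.
Unshelve. all: by end_near. Qed.

(** * The sampling operator at a fixed [n] *)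

Section sampling.
Context {R : realType} (I : set R) (J : set int) (nu : int -> R)
  (K : int -> R -> R).
Implicit Types (f : R -> R) (t M B : R).

Hypothesis K_cont : forall k, J k -> {within I, continuous (K k)}.
Hypothesis K_unif : forall C : set R, compact C -> C `<=` I ->
  {uniform C, abs_partial_sum (J := J) K @ summability.totally -->
    (fun t => summability.sum (fun k : J => `|K (val k) t|))}.

Lemma sampling_op_le f t M B : 0 <= M ->
  (forall k, J k -> `|f (nu k)| <= M) ->
  (forall A, abs_partial_sum (J := J) K A t <= B) ->
  `|sampling_op J nu K f t| <= M * B.
Proof.
move=> M0 fM KB.
rewrite /sampling_op.
apply: (@dominated_usum_le _ _ _
  (fun k : J => M * `|K (val k) t|)) => [k|A].
  by rewrite normrM ler_wpM2r// fM//; exact: set_valP.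
by rewrite partial_sumZ ler_wpM2l//; exact: KB.
Qed.

(** At each point of [C] the remainder of the series is at most [M] times that of the series of the
    [|K_k|], which is uniformly small on [C]. *)
Lemma sampling_op_uniform f M B (C : set R) : 0 <= M ->
  (forall k, J k -> `|f (nu k)| <= M) ->
  (forall t, I t -> forall A, abs_partial_sum (J := J) K A t <= B) ->
  compact C -> C `<=` I ->
  {uniform C, (fun A t => summability.partial_sum
      (fun k : J => f (nu (val k)) * K (val k) t) A) @ summability.totally -->
    sampling_op J nu K f}.
Proof.
move=> M0 fM KB cC CI P /uniform_nbhs[E [+ EP]].
rewrite -entourage_ballE => -[e /= e0 eE].
have M10 : 0 < M + 1 by lra.
(* The denominator [M + 1] covers the case [M = 0] and gives a strict bound below [e] after
   multiplication by [M]. *)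
have e1 : 0 < e / (M + 1) by exact: divr_gt0.
have /(K_unif cC CI)[A _ AP] : nbhs
    ((fun t => summability.sum (fun k : J => `|K (val k) t|)) : {uniform` C -> R})
    [set h | forall y, C y ->
      ball (summability.sum (fun k : J => `|K (val k) y|)) (e / (M + 1)) (h y)].
  apply/uniform_nbhs; exists [set xy | ball xy.1 (e / (M + 1)) xy.2]; split=> //.
  exact: (entourage_ball _ (PosNum e1)).
exists A => // D AD; apply: EP => y Cy; apply: eE => /=.
have := AP D AD y Cy; rewrite /ball/= => KD.
have yB : forall A, summability.partial_sum (fun k : J => M * `|K (val k) y|) A
    <= M * B.
  by move=> A'; rewrite partial_sumZ ler_wpM2l//; apply: KB; exact: CI.
apply: le_lt_trans (dominated_tail_le _ _ yB) _ => [k|].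
  by rewrite normrM ler_wpM2r// fM//; exact: set_valP.
rewrite usumZ; last first.
  by apply: (@nonneg_partial_sum_cvg _ _ _ B) => // A'; apply: KB; exact: CI.
rewrite partial_sumZ -mulrBr; move: KD; rewrite ltr_pdivlMr// mulrC.
apply: le_lt_trans; apply: ler_pM => //; [|lra|exact: ler_norm].
rewrite subr_ge0; apply: nonneg_partial_sum_le => //.
by apply: (@nonneg_partial_sum_cvg _ _ _ B) => // A'; apply: KB; exact: CI.
Qed.

Lemma sampling_op_continuous f M B : is_interval I -> 0 <= M ->
  (forall k, J k -> `|f (nu k)| <= M) ->
  (forall t, I t -> forall A, abs_partial_sum (J := J) K A t <= B) ->
  {within I, continuous (sampling_op J nu K f)}.
Proof.
move=> itvI M0 fM KB; apply/subspace_continuousP => t It.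
have [a [b [abI tab]]] := interval_within_nbhs_segment itvI It.
have /subspace_continuousP/(_ t) ct :
    {within `[a, b], continuous (sampling_op J nu K f)}.
  apply: uniform_limit_continuous_subspace
    (sampling_op_uniform M0 fM KB (segment_compact (a := a) (b := b)) abI).
  exists fset0 => // A _ /=.
  have -> : (fun s => summability.partial_sum
      (fun k : J => f (nu (val k)) * K (val k) s) A) =
      (fun s => \sum_(k <- A) f (nu (val k)) * K (val k) s).
    by apply/funext => s; rewrite partial_sumE.
  apply: continuous_big; first exact: add_continuous.
  move=> k _ s; apply: cvgM; first exact: cvg_cst.
  apply: (continuous_subspaceW abI); apply: K_cont; exact: set_valP.
have tI : `[a, b]%classic t by apply: (nbhs_singleton tab).
(* Points of [I] close to [t] lie in the segment, so continuity at [t] within the segment gives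
   continuity within [I]. *)
move=> P /(ct tI) tP.
apply: (@filterS2 _ (nbhs t) _ _ _ _ _ tab tP) => s sab sP Is.
exact: sP (sab Is).
Qed.

End sampling.

(** The estimate is made at one point [t] with explicit constants, so that it serves both pointwise
    and uniform convergence. *)
Lemma sampling_op_approx {R : realType} (J : set int) (nu : int -> R)
    (K : int -> R -> R) (f : R -> R) (t M B e delta eta : R) :
  0 <= M -> 0 <= e ->
  summability.sum (fun k : J => K (val k) t) = 1 ->
  (forall A, abs_partial_sum (J := J) K A t <= B) ->
  (forall k, J k -> `|f (nu k) - f t| <= M) ->
  (forall k, J k -> `|nu k - t| < delta -> `|f (nu k) - f t| <= e) ->
  (\esum_(k in J `&` [set k | (delta <= `|nu k - t|)%R]) `|K k t|%:E
     <= eta%:E)%E ->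
  `|sampling_op J nu K f t - f t| <= e * B + M * eta.
Proof.
move=> M0 e0 K1 KB fM fe Keta.
have cK : cvg (summability.partial_sum (fun k : J => K (val k) t)
    @ summability.totally).
  exact: (@dominated_partial_sum_cvg _ _ _ (fun k : J => `|K (val k) t|) B).
have cfK : cvg (summability.partial_sum
    (fun k : J => f (nu (val k)) * K (val k) t) @ summability.totally).
  apply: (@dominated_partial_sum_cvg _ _ _
    (fun k : J => (M + `|f t|) * `|K (val k) t|) ((M + `|f t|) * B)) => [k|A].
    rewrite normrM ler_wpM2r// -(subrK (f t) (f _)).
    by rewrite (le_trans (ler_normD _ _))// lerD2r fM//; exact: set_valP.
  by rewrite partial_sumZ ler_wpM2l ?addr_ge0//; exact: KB.
have -> : sampling_op J nu K f t - f t =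
    summability.sum (fun k : J => (f (nu (val k)) - f t) * K (val k) t).
  (* The number [f t] is written as [f t] times the sum of the [K_k], and the two series are
     subtracted termwise. *)
  rewrite -[in LHS](mulr1 (f t)) -K1 /sampling_op -usumZ// -usumB//.
    by congr summability.sum; apply/funext => k /=; rewrite mulrBl.
  by rewrite partial_sumZ; apply: is_cvgM cK; exact: is_cvg_cst.
(* Extension by zero puts near and far indices in one dominating family over [J]; [esum_mkcondr]
   later recovers the restricted sum. *)
pose far k := if delta <= `|nu k - t| then `|K k t| else 0.
apply: (@dominated_usum_le _ _ _
  (fun k : J => e * `|K (val k) t| + M * far (val k))) => [k|A].
  have Jk : J (val k) by exact: set_valP.
  rewrite normrM /far; case: (leP delta) => h; last first.
    by rewrite mulr0 addr0 ler_wpM2r// fe.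
  by rewrite ler_wpDl ?mulr_ge0// ler_wpM2r// fM.
rewrite (partial_sumD (fun k : J => e * `|K (val k) t|)
  (fun k : J => M * far (val k))) /= !partial_sumZ.
apply: lerD; apply: ler_wpM2l => //; first exact: KB.
rewrite -lee_fin; apply: (le_trans (@partial_sum_le_esum _ _ J far A)).
apply: le_trans Keta; rewrite esum_mkcondr; apply: le_esum => k _.
rewrite /far (_ : (k \in _) = (delta <= `|nu k - t|)); first by case: ifP.
by apply/idP/idP => [/set_mem|?]; last exact: mem_set.
Qed.

(** * Row vectors, limits in the extended reals, and the error budget *)

Lemma cvg_rV {R : realType} {T : Type} {F : set_system T} {FF : Filter F}
    (d : nat) (g : T -> 'rV[R]_d) (l : 'rV[R]_d) :
  (forall i, g s ord0 i @[s --> F] --> l ord0 i) -> g @ F --> l.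
Proof.
move=> gl; apply/cvg_ballP => e e0.
(* There are finitely many coordinates, so they can be controlled simultaneously along [F]. *)
have : \forall s \near F, forall i, ball (l ord0 i) e (g s ord0 i).
  by apply: filter_forall => i; move/cvg_ballP : (gl i); exact.
by apply: filterS => s gs; split => // i j; rewrite ord1.
Qed.

Lemma rV_norm_le {R : realType} (d : nat) (v : 'rV[R]_d) (M : R) : 0 <= M ->
  (`|v| <= M) = [forall i, `|v ord0 i| <= M].
Proof.
move=> M0; rewrite [leLHS]/Num.norm/= mx_normrE; apply/bigmax_leP/forallP.
  by move=> [_ vM] i; exact: (vM (ord0, i)).
by move=> vM; split=> // -[i j] _; rewrite ord1.
Qed.

(** Convergence to a finite limit in [\bar R] means eventual finiteness plus convergence of the real
    parts; the bound with [e = 1] gives the finiteness. *)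
Lemma nonneg_cvge0 {R : realType} (u : nat -> \bar R) :
  (forall n, (0 <= u n)%E) ->
  (forall e : R, 0 < e -> \forall n \near \oo, (u n <= e%:E)%E) ->
  u n @[n --> \oo] --> 0%E.
Proof.
move=> u0 ue; apply/fine_cvgP; split.
  apply: filterS (ue _ ltr01) => n un.
  by rewrite ge0_fin_numE// (le_lt_trans un)// ltry.
apply/cvgrPdist_le => e e0; apply: filterS (ue _ e0) => n un /=.
rewrite sub0r normrN ger0_norm ?fine_ge0// -lee_fin fineK//.
by rewrite ge0_fin_numE// (le_lt_trans un)// ltry.
Qed.

Lemma cvge0_near_le {R : realType} (u : nat -> \bar R) (e : R) :
  u n @[n --> \oo] --> 0%E -> 0 < e -> \forall n \near \oo, (u n <= e%:E)%E.
Proof.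
move=> /fine_cvgP[ufin /cvgrPdist_le u0] /u0; apply: filterS2 ufin => n un.
rewrite sub0r normrN -(fineK un) lee_fin/= => /(le_trans _); apply.
exact: ler_norm.
Qed.

(** Each summand is at most [e / 2] because [x / (x + 1) <= 1]; adding [1] allows [B] or [M] to
    vanish. *)
Lemma split_error_le {R : realType} (B M e : R) : 0 <= B -> 0 <= M -> 0 < e ->
  e / 2 / (B + 1) * B + M * (e / 2 / (M + 1)) <= e.
Proof.
have aux (x : R) : 0 <= x -> 0 < e -> e / 2 / (x + 1) * x <= e / 2.
  by move=> x0 e0; rewrite mulrAC ler_pdivrMr; nra.
by move=> B0 M0 e0; have := aux _ B0 e0; have := aux _ M0 e0; lra.
Qed.

(** * Boundedness, continuity and convergence of the sampled curve *)

Theorem corollary2p3 (R : realType) (I : set R) (I_itv : is_interval I)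
  (J : nat -> set int) (nu : nat -> int -> R) (lambda Lambda : nat -> R)
  (K : nat -> int -> R -> R)
  (nu_in : forall n k, (0 < n)%N -> J n k -> I (nu n k))
  (lambda_gt0 : forall n, (0 < n)%N -> 0 < lambda n)
  (Lambda_gt0 : forall n, (0 < n)%N -> 0 < Lambda n)
  (nu_step : forall n k, (0 < n)%N -> J n k -> J n (k + 1) ->
     lambda n < nu n (k + 1) - nu n k <= Lambda n)
  (lambda_cvg : lambda n @[n --> \oo] --> (0 : R))
  (Lambda_cvg : Lambda n @[n --> \oo] --> (0 : R))
  (K_cont : forall n k, (0 < n)%N -> J n k -> {within I, continuous (K n k)})
  (K_sum1 : forall n t, (0 < n)%N -> I t ->
     summability.sum (fun k : J n => K n (val k) t) = 1)
  (K_unif : forall n (C : set R), (0 < n)%N -> compact C -> C `<=` I ->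
     {uniform C, abs_partial_sum (J := J n) (K n) @ summability.totally -->
        (fun t => summability.sum (fun k : J n => `|K n (val k) t|))})
  (K_bound : exists M0 : R, forall n, (0 < n)%N ->
     (ereal_sup [set \esum_(k in J n) `|K n k t|%:E | t in I] < M0%:E)%E)
  (K_conc : forall delta t : R, 0 < delta -> I t ->
     \esum_(k in J n `&` [set k | delta <= `|nu n k - t|]) `|K n k t|%:E
       @[n --> \oo] --> 0%E)
  (d : nat) (d_gt1 : (1 < d)%N) (gamma : R -> 'rV[R]_d)
  (gamma_bnd : [bounded gamma t | t in I]) :
  [/\ forall n, (0 < n)%N ->
        [bounded sampling_op_vec (J n) (nu n) (K n) gamma t | t in I] /\
        {within I, continuous (sampling_op_vec (J n) (nu n) (K n) gamma)},
      forall t, I t -> gamma s @[s --> within I (nbhs t)] --> gamma t ->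
        sampling_op_vec (J n) (nu n) (K n) gamma t @[n --> \oo] --> gamma t &
      @unif_continuous (subspace I) 'rV[R]_d gamma ->
      (forall delta : R, 0 < delta ->
         ereal_sup [set \esum_(k in J n `&` [set k | delta <= `|nu n k - t|])
                          `|K n k t|%:E | t in I]
           @[n --> \oo] --> 0%E) ->
      sup_norm_vec I
        (fun t => sampling_op_vec (J n) (nu n) (K n) gamma t - gamma t)
        @[n --> \oo] --> 0%E].
Proof.
have [M M0 gM] : exists2 M : R, 0 <= M &
    forall t i, I t -> `|gamma t ord0 i| <= M.
  have [M M0 gM] := pinfty_ex_gt0 gamma_bnd.
  exists M; first exact: ltW.
  by move=> t i /gM /=; rewrite (rV_norm_le _ (ltW M0)) => /forallP.
have [B B0 KB] : exists2 B : R, 0 <= B & forall n t, (0 < n)%N -> I t ->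
    forall A, abs_partial_sum (J := J n) (K n) A t <= B.
  (* The absolute value keeps the bound nonnegative even for empty [I], where the supremum is
     [-oo]. *)
  have [B KB] := K_bound; exists `|B| => // n t n0 It A.
  rewrite -lee_fin.
  apply: le_trans (@partial_sum_le_esum _ _ (J n) (fun k => `|K n k t|) A) _.
  rewrite (@le_trans _ _ B%:E) ?lee_fin ?ler_norm//.
  by apply: le_trans (ltW (KB n n0)); apply: ereal_sup_ubound; exists t.
have gnu n i k : (0 < n)%N -> J n k -> `|gamma (nu n k) ord0 i| <= M.
  by move=> n0 Jk; apply/gM/nu_in.
(* Common core of both convergence statements. The tail tolerance involves [M + M], which bounds the
   difference of two values of a coordinate of [gamma]. *)
have approx n t i delta (e : R) : (0 < n)%N -> I t -> 0 < e ->
    (forall s, I s -> `|s - t| < delta ->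
      `|gamma s ord0 i - gamma t ord0 i| <= e / 2 / (B + 1)) ->
    (\esum_(k in J n `&` [set k | (delta <= `|nu n k - t|)%R]) `|K n k t|%:E
      <= (e / 2 / (M + M + 1))%:E)%E ->
    `|sampling_op (J n) (nu n) (K n) (fun s => gamma s ord0 i) t
      - gamma t ord0 i| <= e.
  move=> n0 It e0 ge Ke.
  apply: le_trans (split_error_le B0 (addr_ge0 M0 M0) e0).
  apply: sampling_op_approx Ke => //.
  - by rewrite addr_ge0.
  - by rewrite !divr_ge0 ?addr_ge0// ltW.
  - exact: K_sum1.
  - exact: KB.
  - move=> k Jk; rewrite (le_trans (ler_normB _ _))// lerD// ?gnu//.
    exact: gM.
  - by move=> k Jk; apply: ge; exact: nu_in.
have err0 (b e : R) : 0 <= b -> 0 < e -> 0 < e / 2 / (b + 1).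
  by move=> b0 e0; rewrite !divr_gt0// ltr_wpDl.
split.
- move=> n n0; split.
    exists (M * B); split=> [|x MBx t It /=]; first exact: num_real.
    rewrite (le_trans _ (ltW MBx))// rV_norm_le ?mulr_ge0//; apply/forallP => i; rewrite mxE.
    apply: sampling_op_le => //; first by move=> k; exact: gnu.
    exact: KB.
  apply/subspace_continuousP => t It; apply: cvg_rV => i.
  rewrite mxE; under eq_fun do rewrite mxE.
  have /subspace_continuousP : {within I, continuous
      (sampling_op (J n) (nu n) (K n) (fun s => gamma s ord0 i))}.
    apply: (@sampling_op_continuous _ I _ _ _ _ _ _ M B) => //.
    + by move=> k; exact: K_cont.
    + by move=> C; exact: K_unif.
    + by move=> k; exact: gnu.
    + by move=> s; exact: KB.
  exact.
- move=> t It gt; apply: cvg_rV => i.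
  rewrite (_ : (fun n => _) = fun n => sampling_op (J n) (nu n) (K n)
    (fun s => gamma s ord0 i) t); last by apply/funext => n; rewrite mxE.
  apply/cvgrPdistC_le => e e0.
  have /cvgrPdistC_le/(_ _ (err0 _ _ B0 e0)) :
      gamma s ord0 i @[s --> within I (nbhs t)] --> gamma t ord0 i.
    exact: (cvg_comp _ _ gt (@coord_continuous _ _ _ ord0 i _)).
  rewrite near_withinE => /nbhs_ballP[delta /= delta0 gdelta].
  have := cvge0_near_le (K_conc _ _ delta0 It) (err0 _ _ (addr_ge0 M0 M0) e0).
  (* The hypotheses on the kernels concern [n > 0] only, hence the intersection with this eventual
     condition. *)
  apply: filterS2 (nbhs_infty_gt 0) => n n0; apply: approx => // s Is st.
  by apply: gdelta => //; rewrite /ball/= distrC.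
- move=> /unif_continuousP gunif Kunif; apply: nonneg_cvge0.
    by move=> n; rewrite /sup_norm_vec; apply: bigmax_ge_id.
  move=> e e0.
  (* This [delta] is independent of [t], so one rank [n] from the uniform tail condition serves all
     points of [I]. *)
  have [delta delta0 gdelta] := gunif _ (err0 _ _ B0 e0).
  have := cvge0_near_le (Kunif _ delta0) (err0 _ _ (addr_ge0 M0 M0) e0).
  apply: filterS2 (nbhs_infty_gt 0) => n n0 Kn.
  apply: bigmax_le => [|i _]; first by rewrite lee_fin ltW.
  apply: ge_ereal_sup => _ [t It <-]; rewrite lee_fin !mxE.
  apply: (approx n t i delta) => // [s Is st|]; last first.
    by apply: le_trans Kn; apply: ereal_sup_ubound; exists t.
  have [] : ball (gamma t) (e / 2 / (B + 1)) (gamma s).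
    (* As [t] lies in [I], a subspace ball around [t] is the trace on [I] of the usual ball. *)
    apply: (gdelta (t, s)); rewrite /= ball_subspace_ball /subspace_ball mem_set//.
    by split=> //; rewrite /ball/= distrC.
  by move=> _ /(_ ord0 i); rewrite /ball/= distrC => /ltW.
Qed.
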